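(* The functors $I$, $I_l$, $I_h$ and $I_{l,h}$ are epimorphic. That is, for a fixed $K$ in $Ob(\mathcal K_w)$ (respectively $Ob(\mathcal K)$, $Ob(\mathcal K_{w,l})$, $Ob(\mathcal K_l)$), each of them sends every epimorphism $f:X\to Y$ of sets (of linearly ordered sets with non-decreasing maps, in the cases $I_l$ and $I_{l,h}$) to a surjective map $I(f):I(X,K)\to I(Y,K)$ (respectively $I_l(f)$, $I_h(f)$, $I_{l,h}(f)$).
   Context: Quasirings. A quasiring is a set $K$ with operations $+,\times$ such that $K$ under $+$ and $K\setminus\{0\}$ under $\times$ are groupoids (sets with a binary operation) with neutral elements $0$ and $1$, $a0=0a=0$ for all $a$, and left distributivity $a(b+c)=ab+ac$ or right distributivity $(b+c)a=ba+ca$ holds (no associativity or commutativity is required). Orders. A set is directed by $\le$ if $\le$ is transitive, reflexive and any two elements have a common upper bound; $x<y$ means $x\le y$, $x\ne y$. Linearly ordered: $<$ is transitive, asymmetric, and any two distinct elements are comparable. Well-ordered: linearly ordered and each non-void subset has a least element. An ordered quasiring has order-preserving operations: $a+b\le c+d$ and $ab\le cd$ whenever $a\le c$, $b\le d$ and $a,b,c,d$ lie in a common linearly ordered subset; its minimal element is $0$. Condition (DW): every linearly ordered subset is contained in a well-ordered subset. $\mathcal K$ is the category of directed quasirings satisfying (DW), with order-preserving algebraic homomorphisms; $\mathcal K_w$ is its subcategory of well-ordered quasirings; $\mathcal K_l$ and $\mathcal K_{w,l}$ are the subcategories of left distributive quasirings in $\mathcal K$ and $\mathcal K_w$. Function spaces.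 $C(X,K)$ is the set of all maps $X\to K$ with pointwise operations and order; for linearly ordered $X$, $C_+(X,K)$ is the set of monotone non-decreasing maps. It is a standing assumption that $\sup f(X)$ exists in $K$ for every $f$ in $C(X,K)$ (resp. $C_+(X,K)$). $g^c$ denotes the constant map with value $c\in K$; $c\odot f=g^c+f$, $f\odot c=f+g^c$, and $c\odot d=c+d$ for $c,d\in K$. Functionals. $\nu:C(X,K)\to K$ is left homogeneous if $\nu(bf)=b\,\nu(f)$ for $b\in K$. It is idempotent if $\nu(g^c)=c$, $\nu(c\odot f)=c\odot\nu(f)$, $\nu(f\odot c)=\nu(f)\odot c$ and, whenever $f(x),g(x)$ are comparable for every $x\in X$, $\nu(f\vee g)=\nu(f)\vee\nu(g)$ and $\nu(f\wedge g)=\nu(f)\wedge\nu(g)$, where $\vee,\wedge$ are (pointwise) max and min. The same definitions apply on $C_+(X,K)$. $I(X,K)$ (resp. $I_l(X,K)$) is the set of idempotent functionals on $C(X,K)$ (resp. $C_+(X,K)$); $I_h(X,K)$, $I_{l,h}(X,K)$ are their subsets of left homogeneous functionals. For $f:X\to Y$ (non-decreasing in the cases with index $l$), $(I(f)(\nu))(g)=\nu(g\circ f)$ for $g\in C(Y,K)$ (resp. $C_+(Y,K)$), and likewise for $I_l,I_h,I_{l,h}$. $I,I_h$ are functors on the category of sets; $I_l,I_{l,h}$ on the category of linearly ordered sets and non-decreasing maps. A covariant functor is epimorphic if it preserves epimorphisms. *)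

(* Defs.v *)
From mathcomp Require Import all_boot all_order.
From mathcomp Require Import boolp classical_sets functions.

Set Implicit Arguments.
Unset Strict Implicit.
Unset Printing Implicit Defensive.

Local Open Scope classical_set_scope.

Record quasiring := Quasiring {
  qsort :> Type;
  qzero : qsort;
  qone : qsort;
  qadd : qsort -> qsort -> qsort;
  qmul : qsort -> qsort -> qsort;
  qadd0l : forall a, qadd qzero a = a;
  qadd0r : forall a, qadd a qzero = a;
  qone_neq0 : qone <> qzero;
  (* the nonzero elements are stable under multiplication *)
  qmul_neq0 : forall a b, a <> qzero -> b <> qzero -> qmul a b <> qzero;
  qmul1l : forall a, a <> qzero -> qmul qone a = a;
  qmul1r : forall a, a <> qzero -> qmul a qone = a;
  qmul0l : forall a, qmul qzero a = qzero;
  qmul0r : forall a, qmul a qzero = qzero;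
  qdistr :
    (forall a b c, qmul a (qadd b c) = qadd (qmul a b) (qmul a c)) \/
    (forall a b c, qmul (qadd b c) a = qadd (qmul b a) (qmul c a))
}.

Declare Scope quasiring_scope.
Delimit Scope quasiring_scope with qr.
Bind Scope quasiring_scope with qsort.
Notation "0" := (qzero _) : quasiring_scope.
Notation "1" := (qone _) : quasiring_scope.
Notation "a + b" := (qadd a b) : quasiring_scope.
Notation "a * b" := (qmul a b) : quasiring_scope.

(* [le] is not assumed to be antisymmetric: this only holds on linearly
   ordered subsets, as a consequence of the asymmetry of [slt]. *)
Section Orders.
Variables (T : Type) (le : T -> T -> Prop).

Definition slt (x y : T) : Prop := le x y /\ x <> y.

Definition directed : Prop :=
  [/\ forall x y z, le x y -> le y z -> le x z,
      forall x, le x x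
    & forall x y, exists z, le x z /\ le y z].

Definition linearly_ordered (A : set T) : Prop :=
  [/\ forall x y z, A x -> A y -> A z -> slt x y -> slt y z -> slt x z,
      forall x y, A x -> A y -> slt x y -> ~ slt y x
    & forall x y, A x -> A y -> x <> y -> slt x y \/ slt y x].

Definition well_ordered (A : set T) : Prop :=
  linearly_ordered A /\
  forall S : set T, S `<=` A -> S !=set0 ->
    exists2 m, S m & forall s, S s -> le m s.

Definition op_preserves_order (op : T -> T -> T) : Prop :=
  forall (A : set T) (a b c d : T), linearly_ordered A ->
    A a -> A b -> A c -> A d ->
    le a c -> le b d -> le (op a b) (op c d).

Definition minimal (x : T) : Prop := forall y, ~ slt y x.

Definition is_sup (A : set T) (s : T) : Prop :=
  (forall a, A a -> le a s) /\
  (forall u, (forall a, A a -> le a u) -> le s u).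

Definition is_max (a b m : T) : Prop := [/\ m = a \/ m = b, le a m & le b m].

Definition is_min (a b m : T) : Prop := [/\ m = a \/ m = b, le m a & le m b].

End Orders.

(* The objects of the category K. *)
Record dirQuasiring := DirQuasiring {
  dq_base :> quasiring;
  qle : dq_base -> dq_base -> Prop;
  qle_directed : directed qle;
  qle_add : op_preserves_order qle (@qadd dq_base);
  qle_mul : op_preserves_order qle (@qmul dq_base);
  (* 0 is the minimal element, i.e. the only one *)
  qle_min0 : forall a, minimal qle a <-> a = qzero dq_base;
  (* condition (DW) *)
  qle_DW : forall A : set dq_base, linearly_ordered qle A ->
    exists2 B, well_ordered qle B & A `<=` B
}.
Arguments qle {d}.

(* Membership in Ob(K_w). *)
Definition well_ordered_quasiring (K : dirQuasiring) : Prop :=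
  well_ordered (@qle K) setT.

(* Membership in Ob(K_l); with the previous predicate, in Ob(K_{w,l}). *)
Definition left_distributive_quasiring (K : dirQuasiring) : Prop :=
  forall a b c : K, (a * (b + c) = a * b + a * c)%qr.

Definition C (X : Type) (K : dirQuasiring) : set (X -> K) := setT.
Arguments C : clear implicits.

Definition nondecreasing d d' (X : porderType d) (Y : porderType d')
    (f : X -> Y) : Prop :=
  {homo f : x y / (x <= y)%O}.

Definition Cplus d (X : orderType d) (K : dirQuasiring) : set (X -> K) :=
  [set f | forall x y, (x <= y)%O -> qle (f x) (f y)].
Arguments Cplus {d} X K.

Section Functionals.
Variables (X : Type) (K : dirQuasiring) (D : set (X -> K)).

Definition sups_exist : Prop :=
  forall f : D, exists s, is_sup qle (range (val f)) s.

(* Pointwise operations are stated relationally, since Cplus need not be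
   stable under b f, c \odot f and f \odot c when K is not linearly ordered:
   the identities are required whenever the resulting map is in the domain of
   the functional.  The existence of pointwise maxima (or minima) of f and g
   amounts to the comparability of f x and g x for all x; the conclusion of
   [idem_max] and [idem_min] includes that nu f and nu g are comparable. *)
Record is_idempotent (nu : D -> K) : Prop := {
  idem_cst : forall (c : K) (g : D), (forall x, val g x = c) -> nu g = c;
  idem_odotl : forall (c : K) (f h : D),
    (forall x, val h x = (c + val f x)%qr) -> nu h = (c + nu f)%qr;
  idem_odotr : forall (c : K) (f h : D),
    (forall x, val h x = (val f x + c)%qr) -> nu h = (nu f + c)%qr;
  idem_max : forall f g h : D,
    (forall x, is_max qle (val f x) (val g x) (val h x)) ->
    is_max qle (nu f) (nu g) (nu h);
  idem_min : forall f g h : D,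
    (forall x, is_min qle (val f x) (val g x) (val h x)) ->
    is_min qle (nu f) (nu g) (nu h)
}.

Definition left_homogeneous (nu : D -> K) : Prop :=
  forall (b : K) (f h : D),
    (forall x, val h x = (b * val f x)%qr) -> nu h = (b * nu f)%qr.

Definition idempotents : set (D -> K) := [set nu | is_idempotent nu].

Definition idempotents_h : set (D -> K) :=
  [set nu | is_idempotent nu /\ left_homogeneous nu].

End Functionals.
Arguments idempotents {X K} D.
Arguments idempotents_h {X K} D.

Section Push.
Variables (K : dirQuasiring) (X Y : Type).
Variables (D : set (X -> K)) (E : set (Y -> K)) (f : X -> Y).
Hypothesis fED : forall g, E g -> D (g \o f).

Definition precomp (g : E) : D := SigSub (mem_set (fED (set_valP g))).

Definition push (nu : D -> K) : E -> K := fun g => nu (precomp g).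

Lemma push_idempotents nu : idempotents D nu -> idempotents E (push nu).
Proof.
move=> [nuC nul nur nuM num]; split.
- by move=> c g gE; apply: nuC => x; apply: gE.
- by move=> c g h hE; apply: nul => x; apply: hE.
- by move=> c g h hE; apply: nur => x; apply: hE.
- by move=> g1 g2 h hE; apply: nuM => x; apply: hE.
- by move=> g1 g2 h hE; apply: num => x; apply: hE.
Qed.

Lemma push_idempotents_h nu : idempotents_h D nu -> idempotents_h E (push nu).
Proof.
move=> [nuI nuH]; split; first exact: push_idempotents.
by move=> b g h hE; apply: nuH => x; apply: hE.
Qed.

Definition idem_push (nu : idempotents D) : idempotents E :=
  SigSub (mem_set (push_idempotents (set_valP nu))).

Definition idem_push_h (nu : idempotents_h D) : idempotents_h E :=
  SigSub (mem_set (push_idempotents_h (set_valP nu))).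

End Push.

Lemma C_comp (K : dirQuasiring) (X Y : Type) (f : X -> Y) (g : Y -> K) :
  C Y K g -> C X K (g \o f).
Proof. by []. Qed.

Lemma Cplus_comp (K : dirQuasiring) d d' (X : orderType d) (Y : orderType d')
    (f : X -> Y) (g : Y -> K) :
  nondecreasing f -> Cplus Y K g -> Cplus X K (g \o f).
Proof. by move=> fH gH x y xy; apply/gH/fH. Qed.

Definition I_obj (X : Type) (K : dirQuasiring) : set (C X K -> K) :=
  idempotents (C X K).

Definition Ih_obj (X : Type) (K : dirQuasiring) : set (C X K -> K) :=
  idempotents_h (C X K).

Definition Il_obj d (X : orderType d) (K : dirQuasiring) :
    set (Cplus X K -> K) :=
  idempotents (Cplus X K).

Definition Ilh_obj d (X : orderType d) (K : dirQuasiring) :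
    set (Cplus X K -> K) :=
  idempotents_h (Cplus X K).

Arguments I_obj : clear implicits.
Arguments Ih_obj : clear implicits.
Arguments Il_obj {d} X K.
Arguments Ilh_obj {d} X K.

Definition I_map (K : dirQuasiring) (X Y : Type) (f : X -> Y) :
    I_obj X K -> I_obj Y K :=
  idem_push (@C_comp K X Y f).

Definition Ih_map (K : dirQuasiring) (X Y : Type) (f : X -> Y) :
    Ih_obj X K -> Ih_obj Y K :=
  idem_push_h (@C_comp K X Y f).

Definition Il_map (K : dirQuasiring) d d' (X : orderType d) (Y : orderType d')
    (f : X -> Y) (fH : nondecreasing f) : Il_obj X K -> Il_obj Y K :=
  idem_push (fun g => @Cplus_comp K d d' X Y f g fH).

Definition Ilh_map (K : dirQuasiring) d d' (X : orderType d) (Y : orderType d')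
    (f : X -> Y) (fH : nondecreasing f) : Ilh_obj X K -> Ilh_obj Y K :=
  idem_push_h (fun g => @Cplus_comp K d d' X Y f g fH).

Arguments I_map K {X Y} f.
Arguments Ih_map K {X Y} f.
Arguments Il_map K {d d' X Y f} fH.
Arguments Ilh_map K {d d' X Y f} fH.

(* Epimorphisms of the category of sets and of the category of linearly
   ordered sets with non-decreasing maps. *)
Definition set_epi (X Y : Type) (f : X -> Y) : Prop :=
  forall (Z : Type) (g1 g2 : Y -> Z), g1 \o f = g2 \o f -> g1 = g2.

Definition order_epi d d' (X : orderType d) (Y : orderType d')
    (f : X -> Y) : Prop :=
  forall (d'' : Order.disp_t) (Z : orderType d'') (g1 g2 : Y -> Z),
    nondecreasing g1 -> nondecreasing g2 -> g1 \o f = g2 \o f -> g1 = g2.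

(* Main.v *)
Require Import Defs.
From mathcomp Require Import all_boot all_order.
From mathcomp Require Import boolp classical_sets functions.

(** In both categories an epimorphism [f : X -> Y] is surjective, and choice
    then gives a section [s : Y -> X], with [f (s y) = y]. Over linear orders
    every section of a non-decreasing map is itself non-decreasing, so [s] is a
    morphism of the category at hand: every epimorphism splits there. Any functor
    preserves split epimorphisms: given a functional [mu] over [Y], its push
    forward along [s] is a functional over [X], and [f] sends it back to [mu],
    since [g \o f \o s = g]. The four cases share this argument, stated for
    arbitrary function spaces [D] and [E] exchanged by composition with [f] and
    [s] ([idem_push_surj], [idem_push_h_surj]). *)

Set Implicit Arguments.
Unset Strict Implicit.
Unset Printing Implicit Defensive.

Local Open Scope classical_set_scope.

(** Otherwise the range of [f] and the whole of [Y] would be two subsets with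
    the same pullback along [f]. *)
Lemma set_epi_surj (X Y : Type) (f : X -> Y) :
  set_epi f -> forall y, exists x, f x = y.
Proof.
move=> fE y.
have E : (fun _ : Y => True) = (fun y => exists x, f x = y).
  by apply: fE; apply/funext => x; apply/propext; split=> // _; exists x.
by rewrite -[exists x, _]/((fun y => exists x, f x = y) y) -E.
Qed.

(** The up-sets [{z | y <= z}] and [{z | y < z}] have monotone indicators that
    differ at [y] only; if [y] were not a value of [f], they would agree after
    composition with [f]. *)
Lemma order_epi_surj d d' (X : orderType d) (Y : orderType d') (f : X -> Y) :
  order_epi f -> forall y, exists x, f x = y.
Proof.
move=> fE y; apply: contrapT => yNf.
have leH : nondecreasing (fun z => (y <= z)%O).
  by move=> a b ab; case ya: (y <= a)%O => //; rewrite (Order.POrderTheory.le_trans ya ab).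
have ltH : nondecreasing (fun z => (y < z)%O).
  by move=> a b ab; case ya: (y < a)%O => //; rewrite (Order.POrderTheory.lt_le_trans ya ab).
have /(congr1 (@^~ y)) : (fun z => (y <= z)%O) = (fun z => (y < z)%O).
  apply: fE => //; apply/funext => x /=.
  rewrite Order.POrderTheory.lt_neqAle; case: eqP => // yE.
  by case: yNf; exists x.
by rewrite Order.POrderTheory.lexx Order.POrderTheory.ltxx.
Qed.

Lemma surj_section (X Y : Type) (f : X -> Y) :
  (forall y, exists x, f x = y) -> exists s, cancel s f.
Proof. by move=> /boolp.choice[s sK]; exists s. Qed.

(** If [a <= b] but [s b < s a], applying [f] gives [b <= a], hence [a = b]. *)
Lemma section_nondecreasing d d' (X : orderType d) (Y : orderType d')
    (f : X -> Y) (s : Y -> X) :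
  nondecreasing f -> cancel s f -> nondecreasing s.
Proof.
move=> fH sK a b ab; case: (Order.TotalTheory.leP (s a) (s b)) => // ba.
have := fH _ _ (Order.POrderTheory.ltW ba); rewrite !sK => ba'.
have E : a = b by apply: Order.POrderTheory.le_anti; rewrite ab ba'.
by rewrite E Order.POrderTheory.ltxx in ba.
Qed.

Section PushAlongSection.
Variables (K : dirQuasiring) (X Y : Type).
Variables (D : set (X -> K)) (E : set (Y -> K)) (f : X -> Y) (s : Y -> X).
Hypothesis fED : forall g, E g -> D (g \o f).
Hypothesis sDE : forall h, D h -> E (h \o s).
Hypothesis sK : cancel s f.

Lemma push_section (mu : E -> K) : push fED (push sDE mu) = mu.
Proof.
apply/funext => g; rewrite /push; congr mu.
by apply: val_inj; apply/funext => y /=; rewrite sK.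
Qed.

Lemma idem_push_surj : set_surj setT setT (idem_push fED).
Proof.
move=> mu _; exists (idem_push sDE mu) => //.
by apply: val_inj; exact: push_section.
Qed.

Lemma idem_push_h_surj : set_surj setT setT (idem_push_h fED).
Proof.
move=> mu _; exists (idem_push_h sDE mu) => //.
by apply: val_inj; exact: push_section.
Qed.

End PushAlongSection.

Theorem proposition3p24 (K : dirQuasiring) :
  [/\
    (* I *)
    well_ordered_quasiring K ->
    forall (X Y : Type) (f : X -> Y),
      sups_exist (C X K) -> sups_exist (C Y K) ->
      set_epi f -> set_surj setT setT (I_map K f),
    (* I_l *)
    forall (d d' : Order.disp_t) (X : orderType d) (Y : orderType d')
        (f : X -> Y) (fH : nondecreasing f),
      sups_exist (Cplus X K) -> sups_exist (Cplus Y K) ->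
      order_epi f -> set_surj setT setT (Il_map K fH),
    (* I_h *)
    well_ordered_quasiring K -> left_distributive_quasiring K ->
    forall (X Y : Type) (f : X -> Y),
      sups_exist (C X K) -> sups_exist (C Y K) ->
      set_epi f -> set_surj setT setT (Ih_map K f)
  & (* I_{l,h} *)
    left_distributive_quasiring K ->
    forall (d d' : Order.disp_t) (X : orderType d) (Y : orderType d')
        (f : X -> Y) (fH : nondecreasing f),
      sups_exist (Cplus X K) -> sups_exist (Cplus Y K) ->
      order_epi f -> set_surj setT setT (Ilh_map K fH)].
Proof.
split.
- move=> _ X Y f _ _ /set_epi_surj/surj_section[s sK].
  exact: (idem_push_surj (@C_comp K X Y f) (@C_comp K Y X s) sK).
- move=> d d' X Y f fH _ _ /order_epi_surj/surj_section[s sK].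
  have sH := section_nondecreasing fH sK.
  exact: (idem_push_surj _ (fun h => @Cplus_comp K _ _ _ _ s h sH) sK).
- move=> _ _ X Y f _ _ /set_epi_surj/surj_section[s sK].
  exact: (idem_push_h_surj (@C_comp K X Y f) (@C_comp K Y X s) sK).
- move=> _ d d' X Y f fH _ _ /order_epi_surj/surj_section[s sK].
  have sH := section_nondecreasing fH sK.
  exact: (idem_push_h_surj _ (fun h => @Cplus_comp K _ _ _ _ s h sH) sK).
Qed.
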